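(* Let $c_n$ be the number of $U_k$-equivalence classes of the set $\mathcal{L}_n$ of Łukasiewicz paths of length $n$. Then $\sum_{n\geq 0} c_n x^n=\frac{1-x-\sqrt{1-2x-3x^2}}{2x^2}$, the generating function of the Motzkin numbers.
   Context: A Łukasiewicz path of length $n$ is a sequence of $n$ steps from $\{(1,i): i\geq -1\}$ starting at $(0,0)$, ending at $(n,0)$ and never going below the $x$-axis. Write $D=(1,-1)$, $F=(1,0)$, $U_k=(1,k)$ for $k\geq 1$. Steps are numbered $1,\dots,n$. Two Łukasiewicz paths of the same length are $U_k$-equivalent if for every $k\geq 1$ the set of positions of the steps $U_k$ is the same in both paths. *)

(* Defs.v *)
From HB Require Import structures.
From mathcomp Require Import all_boot all_order all_algebra finmap.
From mathcomp Require Import boolp classical_sets functions cardinality.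

Set Implicit Arguments.
Unset Strict Implicit.
Unset Printing Implicit Defensive.

Import Order.TTheory GRing.Theory Num.Theory.

Local Open Scope classical_set_scope.
Local Open Scope ring_scope.

(** * Formal power series over the rationals *)

Record fps := Fps { coef : nat -> rat }.

Lemma fpsP (f g : fps) : coef f =1 coef g -> f = g.
Proof. by case: f g => [f] [g] /= /funext ->. Qed.

HB.instance Definition _ := gen_eqMixin fps.
HB.instance Definition _ := gen_choiceMixin fps.

Definition fps_const (c : rat) : fps := Fps (fun n => if n == 0%N then c else 0).
Definition fps_X : fps := Fps (fun n => (n == 1%N)%:R).
Definition fps_opp (f : fps) : fps := Fps (fun n => - coef f n).
Definition fps_add (f g : fps) : fps := Fps (fun n => coef f n + coef g n).
Definition fps_mul (f g : fps) : fps :=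
  Fps (fun n => \sum_(i < n.+1) coef f i * coef g (n - i)%N).

Fact fps_addA : associative fps_add.
Proof. by move=> f g h; apply: fpsP => n /=; rewrite addrA. Qed.

Fact fps_addC : commutative fps_add.
Proof. by move=> f g; apply: fpsP => n /=; rewrite addrC. Qed.

Fact fps_add0 : left_id (fps_const 0) fps_add.
Proof. by move=> f; apply: fpsP => n /=; rewrite if_same add0r. Qed.

Fact fps_addN : left_inverse (fps_const 0) fps_opp fps_add.
Proof. by move=> f; apply: fpsP => n /=; rewrite if_same addNr. Qed.

HB.instance Definition _ :=
  GRing.isZmodule.Build fps fps_addA fps_addC fps_add0 fps_addN.

Definition fps_trunc (m : nat) (f : fps) : {poly rat} := \poly_(i < m.+1) coef f i.

Lemma coef_trunc m f i : (i <= m)%N -> (fps_trunc m f)`_i = coef f i.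
Proof. by move=> im; rewrite coef_poly ltnS im. Qed.

Lemma coef_mul (f g : fps) n :
  coef (fps_mul f g) n = \sum_(i < n.+1) coef f i * coef g (n - i)%N.
Proof. by []. Qed.

Lemma coef_mul_trunc m f g n : (n <= m)%N ->
  coef (fps_mul f g) n = (fps_trunc m f * fps_trunc m g)`_n.
Proof.
move=> nm; rewrite coefM coef_mul; apply: eq_bigr => i _.
have im : (i <= m)%N by rewrite (leq_trans _ nm) // -ltnS.
by rewrite !coef_trunc // (leq_trans (leq_subr _ _)).
Qed.

Fact fps_mulC : commutative fps_mul.
Proof.
by move=> f g; apply: fpsP => n; rewrite !(@coef_mul_trunc n) // mulrC.
Qed.

Fact fps_mulA : associative fps_mul.
Proof.
move=> f g h; apply: fpsP => n.
transitivity ((fps_trunc n f * (fps_trunc n g * fps_trunc n h))`_n).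
  rewrite coefM coef_mul; apply: eq_bigr => i _.
  rewrite coef_trunc; last by rewrite -ltnS.
  by rewrite -(@coef_mul_trunc n) ?leq_subr.
rewrite mulrA coefM coef_mul; apply: eq_bigr => i _.
rewrite [X in _ * X = _]coef_trunc ?leq_subr //.
by rewrite -(@coef_mul_trunc n) // -ltnS.
Qed.

Fact fps_mul1 : left_id (fps_const 1) fps_mul.
Proof.
move=> f; apply: fpsP => n /=; rewrite big_ord_recl /= subn0 mul1r.
by rewrite big1 ?addr0 // => i _; rewrite mul0r.
Qed.

Fact fps_mulDl : left_distributive fps_mul fps_add.
Proof.
move=> f g h; apply: fpsP => n /=; rewrite -big_split /=.
by apply: eq_bigr => i _; rewrite mulrDl.
Qed.

Fact fps_one_neq0 : fps_const 1 != 0.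
Proof. by apply/eqP => /(congr1 (fun f : fps => coef f 0)). Qed.

HB.instance Definition _ := GRing.Zmodule_isComNzRing.Build fps
  fps_mulA fps_mulC fps_mul1 fps_mulDl fps_one_neq0.

Definition fps_unit : {pred fps} := fun f => `[< exists g : fps, g * f = 1 >].
Definition fps_inv (f : fps) : fps := xget f [set g : fps | g * f = 1].

Fact fps_mulVf : {in fps_unit, left_inverse 1 fps_inv *%R}.
Proof. by move=> f /asboolP fU; exact: (xgetPex f fU). Qed.

Fact fps_unitPl (f g : fps) : g * f = 1 -> fps_unit f.
Proof. by move=> gf; apply/asboolP; exists g. Qed.

Fact fps_inv_out : {in [predC fps_unit], fps_inv =1 id}.
Proof.
by move=> f /asboolPn fN; apply: xgetPN => g gf; apply: fN; exists g.
Qed.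

HB.instance Definition _ := GRing.ComNzRing_hasMulInverse.Build fps
  fps_mulVf fps_unitPl fps_inv_out.

Lemma coefM_fps (f g : fps) n :
  coef (f * g) n = \sum_(i < n.+1) coef f i * coef g (n - i)%N.
Proof. by []. Qed.

Lemma fps_low (f : fps) : f != 0 ->
  exists2 m, coef f m != 0 & forall i, (i < m)%N -> coef f i = 0.
Proof.
move=> f0; have ex : exists m, coef f m != 0.
  apply: contrapT => fN; case/eqP: f0; apply: fpsP => n /=; rewrite if_same.
  by apply/eqP; apply: contrapT => /negP fn; apply: fN; exists n.
case: (ex_minnP ex) => m fm min_m; exists m => // i im.
by apply/eqP; apply: contraTT im => fi; rewrite -leqNgt min_m.
Qed.

Fact fps_integral (f g : fps) : f * g = 0 -> (f == 0) || (g == 0).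
Proof.
move=> fg0; apply/norP => -[/fps_low[m fm fi] /fps_low[p gp gi]].
have := congr1 (fun h : fps => coef h (m + p)) fg0.
rewrite coefM_fps /= if_same.
have mlt : (m < (m + p).+1)%N by rewrite ltnS leq_addr.
rewrite (bigD1 (Ordinal mlt)) //= addKn big1 => [|i im].
  by apply/eqP; rewrite addr0 mulf_neq0.
have [lt_im|lt_mi|e] := ltngtP i m; first by rewrite fi ?mul0r.
  rewrite gi ?mulr0 // ltn_subLR ?ltn_add2r //.
  by rewrite -ltnS.
by case/eqP: im; apply: val_inj.
Qed.

HB.instance Definition _ := GRing.ComUnitRing_isIntegral.Build fps fps_integral.

(** The square root of a series with constant term [1]: the unique series with
    constant term [1] whose square is the given one, see [fps_sqrtP] and
    [fps_sqrt_unique]. *)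
Definition fps_sqrt (f : fps) : fps :=
  xget 0 [set s : fps | coef s 0 = 1 /\ s ^+ 2 = f].

Section SqrtExists.
Variable f : fps.
Hypothesis f0 : coef f 0 = 1.

Let next (s : seq rat) : rat :=
  (coef f (size s) - \sum_(i < (size s).-1) s`_i.+1 * s`_(size s - i.+1)) / 2%:R.

Let pre n : seq rat := iter n (fun s => rcons s (next s)) [:: 1].

Let size_pre n : size (pre n) = n.+1.
Proof. by elim: n => //= n IH; rewrite size_rcons IH. Qed.

Let nth_pre n m i : (i <= n <= m)%N -> (pre m)`_i = (pre n)`_i.
Proof.
case/andP=> le_in; elim: m => [|m IH]; first by rewrite leqn0 => /eqP ->.
rewrite leq_eqVlt => /predU1P[-> //|]; rewrite ltnS => le_nm /=.
by rewrite nth_rcons size_pre ltnS (leq_trans le_in) // IH.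
Qed.

Let s : fps := Fps (fun n => (pre n)`_n).

Lemma fps_sqrt_exists : exists s : fps, coef s 0 = 1 /\ s ^+ 2 = f.
Proof.
exists s; split=> //; apply: fpsP => -[|n].
  by rewrite expr2 coefM_fps big_ord1 /= mul1r f0.
rewrite expr2 coefM_fps big_ord_recl big_ord_recr /= subn0 subnn.
have -> : (rcons (pre n) (next (pre n)))`_n.+1 = next (pre n).
  by rewrite nth_rcons size_pre ltnn eqxx.
have nxt : next (pre n) *+ 2 = coef f n.+1 -
    \sum_(i < n) (pre n)`_i.+1 * (pre n)`_(n.+1 - i.+1).
  by rewrite -mulr_natr /next size_pre divfK.
rewrite [X in _ + (X + _)](_ : _ =
    \sum_(i < n) (pre n)`_i.+1 * (pre n)`_(n.+1 - i.+1)); last first.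
  apply: eq_bigr => i _; rewrite /= /bump /= !add1n subSS.
  rewrite -(@nth_pre i.+1 n i.+1) ?leqnn ?ltn_ord //=.
  by rewrite -(@nth_pre (n - i) n) ?leqnn ?leq_subr.
by rewrite mul1r mulr1 addrCA -mulr2n nxt addrCA subrr addr0.
Qed.

End SqrtExists.

Lemma fps_sqrtP (f : fps) : coef f 0 = 1 ->
  coef (fps_sqrt f) 0 = 1 /\ fps_sqrt f ^+ 2 = f.
Proof. by move=> f0; exact: (xgetPex 0 (fps_sqrt_exists f0)). Qed.

Lemma fps_sqrt_unique (f s : fps) :
  coef s 0 = 1 -> s ^+ 2 = f -> fps_sqrt f = s.
Proof.
move=> s0 sf; apply: xget_unique => // t [t0 tf].
have /eqP : t ^+ 2 = s ^+ 2 by rewrite tf sf.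
rewrite eqf_sqr => /predU1P[// | /eqP ts].
by have := congr1 (fun h : fps => coef h 0) ts; rewrite /= t0 s0.
Qed.

Definition ogf (a : nat -> nat) : fps := Fps (fun n => (a n)%:R).

(** * Lukasiewicz paths *)

(** A path of length [n] is given by its vertical increments: the step [(1, i)]
    is encoded by the integer [i]. *)
Definition height (n : nat) (p : n.-tuple int) (j : nat) : int :=
  \sum_(i < n | (i < j)%N) tnth p i.

Definition lukasiewicz (n : nat) : set (n.-tuple int) :=
  [set p | [/\ forall i, -1 <= tnth p i,
               forall j, (j <= n)%N -> 0 <= height p j
             & height p n = 0]].
Arguments lukasiewicz : clear implicits.

Definition U_positions (n : nat) (k : nat) (p : n.-tuple int) : set 'I_n :=
  [set i | tnth p i = k%:Z].

Definition U_equiv (n : nat) (p q : n.-tuple int) : Prop :=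
  forall k : nat, (1 <= k)%N -> U_positions k p = U_positions k q.

Definition U_class (n : nat) (p : n.-tuple int) : set (n.-tuple int) :=
  [set q | lukasiewicz n q /\ U_equiv p q].

Definition U_classes (n : nat) : set (set (n.-tuple int)) :=
  [set U_class p | p in lukasiewicz n].
Arguments U_classes : clear implicits.

(** [fset_set] is meaningful here because the sets involved are finite, see
    [finite_U_classes] and [finite_motzkin]. *)
Definition num_U_classes (n : nat) : nat := #|` fset_set (U_classes n)|%fset.

Definition motzkin (n : nat) : set (n.-tuple int) :=
  [set p | lukasiewicz n p /\ forall i, tnth p i <= 1].
Arguments motzkin : clear implicits.

Definition motzkin_number (n : nat) : nat := #|` fset_set (motzkin n)|%fset.

Lemma lukasiewicz_le n (p : n.-tuple int) i : lukasiewicz n p -> tnth p i <= n%:Z.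
Proof.
case=> p1 p0 pn; have := p0 i (ltnW (ltn_ord i)); rewrite /height => h0.
have := pn; rewrite /height (bigID (fun j : 'I_n => (j < i)%N)) /=.
rewrite [X in _ + X](bigD1 i) /= ?ltn_ord ?ltnn //.
under eq_bigl => j do rewrite ltn_ord /=.
set A := \sum_(j < n | _) _ in h0 *; set B := \sum_(j < n | _) _ => e.
have : - n%:Z <= B.
  apply: (@le_trans _ _ (\sum_(j < n | (j < n)%N && ~~ (j < i)%N && (j != i)) -1)).
    rewrite sumr_const mulNrn lerN2 -natz ler_nat.
    by rewrite (leq_trans (max_card _)) ?card_ord.
  by apply: ler_sum => j _; apply: p1.
have -> : B = - (A + tnth p i) by apply/eqP; rewrite -addr_eq0 addrC -addrA e.
by rewrite lerN2; apply: le_trans; rewrite lerDr.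
Qed.

Lemma finite_lukasiewicz n : finite_set (lukasiewicz n).
Proof.
pose F (t : n.-tuple 'I_n.+2) : n.-tuple int :=
  map_tuple (fun i : 'I_n.+2 => (i : nat)%:Z - 1) t.
apply: (@sub_finite_set _ _ (F @` setT)); last exact/finite_image/finite_finset.
move=> p Lp; have Lp1 : forall i, -1 <= tnth p i by case: Lp.
exists [tuple inord (absz (tnth p i + 1)) | i < n] => //.
apply: eq_from_tnth => i; rewrite tnth_map tnth_mktuple.
have p0 : 0 <= tnth p i + 1 by rewrite -lerBlDr sub0r.
have absE : (absz (tnth p i + 1))%:Z = tnth p i + 1 by rewrite gez0_abs.
rewrite inordK ?absE ?addrK // ltnS -lez_nat absE -addn1 PoszD lerD2r.
exact: lukasiewicz_le.
Qed.

Lemma finite_U_classes n : finite_set (U_classes n).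
Proof. exact/finite_image/finite_lukasiewicz. Qed.

Lemma finite_motzkin n : finite_set (motzkin n).
Proof. by apply: sub_finite_set (@finite_lukasiewicz n) => p []. Qed.

(* Main.v *)
Require Import Defs.
From mathcomp Require Import all_boot all_order all_algebra.
From mathcomp Require Import finmap boolp classical_sets cardinality.
From mathcomp Require Import zify ring lra.

Set Implicit Arguments.
Unset Strict Implicit.
Unset Printing Implicit Defensive.

Import Order.TTheory GRing.Theory Num.Theory.
Local Open Scope ring_scope.

(** A class is determined by the up-steps of its members: the sequence [a] with
    [a_i = k] if step [i] is [U_k], and [a_i = 0] if it is [D] or [F].  Such an
    [a] comes from a path if and only if descending whenever the height is
    positive leads to height [0], because this choice stays below every path
    with the same up-steps.  So classes correspond to walks on the naturals
    reflected at [0].  Let [w n h] and [m n h] be the numbers of reflected walks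
    and of Motzkin walks of length [n] from height [h] to [0].  Then
    [m n 0 = w n 0] and [m n h.+1 = \sum_j 'C(j, h) * w n j.+1], by induction on
    [n].  The root [f] of [f = 1 + x f + x^2 f^2] satisfies
    [[x^n] (x f)^h f = m n h], which identifies [f] with the Motzkin series. *)

(** * Enumeration of walks by their lists of steps *)

Section Walks.
Context {T : eqType}.
Variables (steps : nat -> nat -> seq T) (move : nat -> T -> nat).

(** The first argument of [steps] is the number of steps still to come, so that an infinite step set
    can be cut down to a finite list. *)
Fixpoint walks (n h : nat) : seq (seq T) :=
  if n is m.+1 then [seq x :: s | x <- steps m h, s <- walks m (move h x)]
  else if h == 0%N then [:: [::]] else [::].

Lemma uniq_walks n h : (forall m k, uniq (steps m k)) -> uniq (walks n h).
Proof.
move=> steps_uniq; elim: n h => [|n IHn] h /=; first by case: ifP.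
apply: allpairs_uniq_dep => // -[x s] [y t] _ _ /= [exy est].
by rewrite exy est.
Qed.

Lemma size_walksS n h :
  size (walks n.+1 h) = (\sum_(x <- steps n h) size (walks n (move h x)))%N.
Proof. by rewrite /= size_allpairs_dep sumnE big_map. Qed.

Lemma mem_walks0 h s : (s \in walks 0 h) = (h == 0%N) && (s == [::]).
Proof. by rewrite /=; case: ifP => _; rewrite ?inE ?in_nil. Qed.

Lemma mem_walksS n h x s :
  (x :: s \in walks n.+1 h) = (x \in steps n h) && (s \in walks n (move h x)).
Proof.
apply/allpairsPdep/andP => [[y [t [y_in t_in [-> ->]]]] // | [x_in s_in]].
by exists x, s.
Qed.

Lemma nil_notin_walksS n h : ([::] \in walks n.+1 h) = false.
Proof. by apply/negP => /allpairsPdep[x [s []]]. Qed.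

End Walks.

(** [F] and [G] have the same fibres on [A], so the values of [F] can be counted by listing those of
    [G]: classes through their up-steps, Motzkin paths through their underlying lists. *)
Lemma card_fset_set_image (S : Type) (T : choiceType) (U : eqType)
    (A : set S) (F : S -> T) (G : S -> U) (s : seq U) :
  uniq s -> (forall u, u \in s <-> exists2 p, A p & G p = u) ->
  (forall p q, A p -> A q -> F p = F q <-> G p = G q) ->
  #|` fset_set [set F p | p in A]%classic|%fset = size s.
Proof.
move=> s_uniq sP FG.
have [A0 | /set0P[p0 Ap0]] := eqVneq A set0.
  rewrite A0 image_set0 fset_set0 cardfs0; case: s {s_uniq} sP => // u s sP.
  by have [p] := (sP u).1 (mem_head _ _); rewrite A0.
(* [r] turns a listed value of [G] into the matching value of [F]; off the list it takes the
   arbitrary value [F p0]. *)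
have /choice[r rP] : forall u, exists x, u \in s ->
    exists2 p, A p & G p = u /\ F p = x.
  move=> u; have [us|] := boolP (u \in s); last by exists (F p0).
  by have [p Ap Gp] := (sP u).1 us; exists (F p) => _; exists p.
have r_uniq : uniq (map r s).
  rewrite map_inj_in_uniq // => u v /rP[p Ap [<- <-]] /rP[q Aq [<- <-]].
  by move/(FG p q Ap Aq).
rewrite -(size_map r) -(undup_id r_uniq) -(size_seq_fset tt).
congr (#|` _|%fset).
have -> : [set F p | p in A]%classic = [set` map r s]%classic.
  apply/predeqP => x; split=> [[p Ap <-] | /mapP[u /rP[p Ap [_ <-]] ->]].
    have us : G p \in s by apply/sP; exists p.
    have [q Aq [Gqp Fq]] := rP _ us.
    by apply/mapP; exists (G p); rewrite // -Fq; apply/FG.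
  by exists p.
apply/fsetP => x; rewrite seq_fsetE in_fset_set; last exact: finite_seq.
by apply/idP/idP => [/set_mem | /mem_set].
Qed.

(** * Reflected walks on the naturals *)

Definition up (x : int) : nat := if x is Posz k then k else 0%N.

Definition reflect_step (h a : nat) : nat := if a is 0 then h.-1 else (h + a)%N.

(** With [n] steps left, an up-step larger than [n] cannot be undone, since each step descends by at
    most one; the bound on the steps loses no walk ending at [0]. *)
Definition up_walks := walks (fun n _ => iota 0 n.+1) reflect_step.

Lemma leq_foldl_reflect h a : (h <= foldl reflect_step h a + size a)%N.
Proof.
elim: a h => [|x a IHa] h /=; first by rewrite addn0.
have := IHa (reflect_step h x); rewrite {1}/reflect_step.
by case: x => [|x]; lia.
Qed.

Lemma mem_up_walks n h a :
  (a \in up_walks n h) = (size a == n) && (foldl reflect_step h a == 0%N).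
Proof.
elim: n h a => [|n IHn] h [|x a].
- by rewrite mem_walks0 andbT.
- by rewrite mem_walks0 andbF.
- by rewrite nil_notin_walksS.
rewrite mem_walksS IHn mem_iota /= add0n eqSS.
case: eqP => [size_a|]; last by rewrite !andbF.
case: eqP => [fold0|]; last by rewrite !andbF.
have := leq_foldl_reflect (reflect_step h x) a.
by rewrite fold0 /reflect_step; case: x {fold0} => [|x]; lia.
Qed.

(** * Motzkin walks and Łukasiewicz paths as lists *)

Definition motzkin_steps (h : nat) : seq int :=
  if h is 0 then [:: 0; 1] else [:: -1; 0; 1].

(** The allowed steps keep [h + x] nonnegative, so [absz] merely changes its type. *)
Definition motzkin_walks :=
  walks (fun _ => motzkin_steps) (fun h x => absz (h%:Z + x)).

Fixpoint lukasiewicz_from (h : int) (s : seq int) : bool :=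
  if s is x :: s' then [&& -1 <= x, 0 <= h + x & lukasiewicz_from (h + x) s']
  else h == 0.

Lemma lukasiewicz_fromP h s : 0 <= h ->
  reflect [/\ forall x, x \in s -> -1 <= x,
              forall j, (j <= size s)%N -> 0 <= h + \sum_(x <- take j s) x
            & h + \sum_(x <- s) x = 0]
          (lukasiewicz_from h s).
Proof.
elim: s h => [|x s IHs] h h_ge0 /=.
  rewrite big_nil addr0; apply: (iffP eqP) => [-> | []//].
  by split=> // j _; rewrite big_nil.
apply: (iffP and3P) => [[x_ge hx_ge0 /(IHs _ hx_ge0)[s_ge s_pos s_end]] |].
  split=> [y | [|j] |].
  - by rewrite inE => /predU1P[-> | /s_ge].
  - by rewrite big_nil addr0.
  - by rewrite /= ltnS big_cons addrA; apply: s_pos.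
  - by rewrite big_cons addrA.
case=> s_ge s_pos s_end.
have hx_ge0 : 0 <= h + x by have := s_pos 1%N isT; rewrite /= take0 big_seq1.
split=> //; first by apply: s_ge; rewrite mem_head.
apply/IHs => //; split=> [y ys | j js |].
- by apply: s_ge; rewrite inE ys orbT.
- by have := s_pos j.+1 js; rewrite big_cons addrA.
- by move: s_end; rewrite big_cons addrA.
Qed.

Lemma heightE n (p : n.-tuple int) j : height p j = \sum_(x <- take j p) x.
Proof.
have -> : take j p = mask (nseq j true) p.
  by elim: (tval p) j => [|x s IHs] [|j] //=; rewrite IHs.
rewrite big_mask_tuple; apply: eq_bigl => i.
by rewrite nth_nseq andbT; case: ifP.
Qed.

Lemma lukasiewiczE n (p : n.-tuple int) :
  lukasiewicz n p <-> lukasiewicz_from 0 p.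
Proof.
split=> [[p_ge p_pos p_end] | /(lukasiewicz_fromP _ (lexx 0))[]].
  apply/lukasiewicz_fromP => //; rewrite size_tuple add0r; split.
  - by move=> x /tnthP[i ->].
  - by move=> j /p_pos; rewrite heightE add0r.
  - by move: p_end; rewrite heightE take_oversize ?size_tuple.
rewrite size_tuple add0r => p_ge p_pos p_end; split.
- by move=> i; apply: p_ge; rewrite mem_tnth.
- by move=> j /p_pos; rewrite add0r heightE.
- by rewrite heightE take_oversize ?size_tuple.
Qed.

Lemma mem_motzkin_walks n h s :
  (s \in motzkin_walks n h) =
  [&& size s == n, lukasiewicz_from h s & all (fun x => x <= 1) s].
Proof.
elim: n h s => [|n IHn] h [|x s].
- by rewrite mem_walks0 /= !andbT.
- by rewrite mem_walks0 andbF.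
- by rewrite nil_notin_walksS.
rewrite mem_walksS IHn /= eqSS.
have -> : (x \in motzkin_steps h) = [&& -1 <= x, 0 <= h%:Z + x & x <= 1].
  by case: h => [|h]; rewrite !inE; lia.
case: (lerP 0 (h%:Z + x)) => hx; last by rewrite !(andbF, andFb).
rewrite gez0_abs //=; do !case: (_ == _); do !case: (_ <= _) => //=.
all: by rewrite ?andbT ?andbF.
Qed.

(** * Classes as reflected walks *)

Lemma foldl_reflect_lukasiewicz (g h : nat) s :
  (g <= h)%N -> lukasiewicz_from h s ->
  foldl reflect_step g [seq up x | x <- s] = 0%N.
Proof.
elim: s g h => [|x s IHs] g h /= le_gh; first by move/eqP; lia.
case/and3P => x_ge hx_ge0.
(* The order [g <= h] persists: an up-step raises both heights equally, and otherwise the reflected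
   walk descends unless it is already at [0]. *)
rewrite -(gez0_abs hx_ge0); apply: IHs.
by case: x x_ge hx_ge0 => [[|k]|k] /=; rewrite ?NegzE; lia.
Qed.

(* Descend as early as possible: flat steps occur at height [0] only. *)
Fixpoint greedy (h : nat) (a : seq nat) : seq int :=
  if a is x :: a' then
    ((reflect_step h x)%:Z - h%:Z) :: greedy (reflect_step h x) a'
  else [::].

Lemma size_greedy h a : size (greedy h a) = size a.
Proof. by elim: a h => //= x a IHa h; rewrite IHa. Qed.

Lemma up_greedy h a : [seq up x | x <- greedy h a] = a.
Proof.
elim: a h => //= x a IHa h; rewrite IHa; congr (_ :: _).
case: x => [|x] /=; last by rewrite PoszD addrAC subrr add0r.
by case: h => //= h; rewrite -addn1 PoszD opprD addNKr.
Qed.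

Lemma lukasiewicz_greedy h a :
  foldl reflect_step h a = 0%N -> lukasiewicz_from h (greedy h a).
Proof.
elim: a h => [|x a IHa] h /= fold0; first by rewrite fold0.
rewrite addrCA subrr addr0 IHa // andbT.
by case: x {fold0} => [|x] /=; lia.
Qed.

Lemma U_equivE n (p q : n.-tuple int) :
  U_equiv p q <-> [seq up x | x <- p] = [seq up x | x <- q].
Proof.
have upE k x : (0 < k)%N -> up x = k <-> x = k%:Z.
  by case: x => y k_gt0 /=; split=> //; [move=> -> | case | lia].
split=> [eq_pq | eq_pq k k_gt0].
  suff : map_tuple up p = map_tuple up q by move=> /(congr1 val).
  apply: eq_from_tnth => i; rewrite !tnth_map.
  have eq_pos k : (0 < k)%N -> up (tnth p i) = k <-> up (tnth q i) = k.
    move=> k_gt0; rewrite !upE //.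
    have /(congr1 (fun A => A i)) := eq_pq k k_gt0.
    by rewrite /U_positions /= => ->.
  (* Only positive values are compared by [eq_pos]; zeros agree because a positive value on one side
     would carry over to the other. *)
  have [q0|q_gt0] := posnP (up (tnth q i)); last exact/eq_pos.
  have [p0|p_gt0] := posnP (up (tnth p i)); first by rewrite p0.
  by rewrite ((eq_pos _ p_gt0).1 erefl).
have eq_tuple : map_tuple up p = map_tuple up q by apply: val_inj.
apply/predeqP => i; rewrite /U_positions /= -!upE //.
by have := congr1 (fun t => tnth t i) eq_tuple; rewrite !tnth_map => ->.
Qed.

Lemma U_class_eq n (p q : n.-tuple int) : lukasiewicz n q ->
  U_class p = U_class q <-> [seq up x | x <- p] = [seq up x | x <- q].
Proof.
move=> q_luk; split=> [eq_cl | eq_pq].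
  suff [_] : U_class p q by move/U_equivE.
  by rewrite eq_cl; split=> // k.
apply/predeqP => r; rewrite /U_class /=.
by split=> -[r_luk /U_equivE r_eq]; split=> //; apply/U_equivE;
  rewrite -r_eq.
Qed.

Lemma num_U_classesE n : num_U_classes n = size (up_walks n 0).
Proof.
apply: (@card_fset_set_image _ _ _ _ _ (fun p : n.-tuple int => map up p)).
- by apply: uniq_walks => *; apply: iota_uniq.
- move=> a; rewrite mem_up_walks; split=> [/andP[size_a /eqP fold0] | [p]].
    have size_g : size (greedy 0 a) == n by rewrite size_greedy.
    exists (Tuple size_g); last exact: up_greedy.
    by apply/lukasiewiczE/lukasiewicz_greedy.
  move=> /lukasiewiczE p_luk <-; rewrite size_map size_tuple eqxx /=.
  exact/eqP/(foldl_reflect_lukasiewicz (leqnn 0) p_luk).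
- by move=> p q _; apply: U_class_eq.
Qed.

Lemma motzkin_numberE n : motzkin_number n = size (motzkin_walks n 0).
Proof.
rewrite /motzkin_number -[motzkin n]image_id.
apply: (@card_fset_set_image _ _ _ _ id val).
- by apply: uniq_walks => _ [].
- move=> s; rewrite mem_motzkin_walks.
  split=> [/and3P[size_s s_luk /allP s_le] | [p [/lukasiewiczE p_luk p_le] <-]].
    exists (Tuple size_s) => //; split; first exact/lukasiewiczE.
    by move=> i; apply/s_le/mem_tnth.
  rewrite size_tuple eqxx p_luk; apply/allP => x /tnthP[i ->].
  exact: p_le.
- by move=> p q _ _; split=> [-> | /val_inj].
Qed.

(** * Recurrences and comparison of the two counts *)

Lemma size_up_walksS n h :
  size (up_walks n.+1 h) =
    (size (up_walks n h.-1) + \sum_(i < n) size (up_walks n (h + i.+1)))%N.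
Proof.
rewrite /up_walks size_walksS -[iota 0 n.+1]/(0%N :: iota 1 n) big_cons.
congr (_ + _)%N; rewrite -[1%N]addn0 iotaDl big_map.
by rewrite -[n in iota 0 n]subn0 -/(index_iota 0 n) big_mkord.
Qed.

Lemma size_up_walks_gt n h : (n < h)%N -> size (up_walks n h) = 0%N.
Proof.
move=> lt_nh; apply/eqP; rewrite size_eq0; apply/eqP.
case def_w: (up_walks n h) => [// | a w].
have := mem_up_walks n h a; rewrite def_w mem_head.
case/esym/andP => /eqP size_a /eqP fold0.
by have := leq_foldl_reflect h a; rewrite fold0 size_a leqNgt lt_nh.
Qed.

Lemma size_motzkin_walksS n h :
  size (motzkin_walks n.+1 h) =
    ((if h is k.+1 then size (motzkin_walks n k) else 0) +
     size (motzkin_walks n h) + size (motzkin_walks n h.+1))%N.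
Proof.
rewrite /motzkin_walks size_walksS; case: h => [|h].
  by rewrite !big_cons big_nil addn0.
rewrite !big_cons big_nil addn0 addnA; congr (_ + _ + _)%N.
- by congr (size (walks _ _ _ _)); lia.
- by congr (size (walks _ _ _ _)); lia.
- by congr (size (walks _ _ _ _)); lia.
Qed.

Lemma sum_bin_hockey n k : (\sum_(i < n) 'C(i, k) = 'C(n, k.+1))%N.
Proof.
elim: n => [|n IHn]; first by rewrite big_ord0.
by rewrite big_ord_recr IHn binS.
Qed.

(** Moving [h] from the argument of [F] into an indicator makes the summand separable, so that a
    further sum over [h] can be exchanged with this one. *)
Lemma sum_shift (F : nat -> nat) n h : (forall i, (n < i)%N -> F i = 0%N) ->
  (\sum_(i < n) F (h + i.+1) = \sum_(i < n) (h <= i) * F i.+1)%N.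
Proof.
move=> F0; transitivity (\sum_(h <= i < h + n) F i.+1)%N.
  rewrite -{2}[h]add0n big_addn addKn big_mkord.
  by apply: eq_bigr => i _; rewrite addnS addnC.
rewrite (big_nat_widenl h 0) //.
rewrite -(big_mkord xpredT (fun i => (h <= i) * F i.+1)%N).
rewrite (big_nat_widen 0 n (h + n)) ?leq_addl // big_mkcond [RHS]big_mkcond.
apply: eq_bigr => i _ /=; case: (leqP h i) => _; case: (ltnP i n) => // le_ni.
- by rewrite mul1n.
- by rewrite F0.
Qed.

(* In generating functions, a height [h] contributes a factor [P^h] for reflected
   walks and [Q^h] for Motzkin walks, with [Q = P / (1 - P)]; the binomials are
   the coefficients of [Q^h.+1] in powers of [P]. *)
Lemma size_motzkin_walks_up n :
  size (motzkin_walks n 0) = size (up_walks n 0) /\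
  forall h, size (motzkin_walks n h.+1) =
    (\sum_(j < n) 'C(j, h) * size (up_walks n j.+1))%N.
Proof.
elim: n => [|n [IH0 IHn]]; first by split=> // h; rewrite big_ord0.
split=> [|h].
  rewrite size_motzkin_walksS size_up_walksS add0n IH0 IHn; congr (_ + _)%N.
  by apply: eq_bigr => j _; rewrite bin0 mul1n.
(* After the exchange, [size (up_walks n i.+1)] has as coefficient the sum of ['C(j, h)] over
   [j < i], a hockey-stick sum. *)
have sum_tails : (\sum_(j < n.+1) 'C(j, h) *
    \sum_(i < n) size (up_walks n (j.+1 + i.+1)) =
    \sum_(i < n) 'C(i, h.+1) * size (up_walks n i.+1))%N.
  under eq_bigr => j _.
    rewrite (sum_shift (F := fun k => size (up_walks n k))); last first.
      exact: size_up_walks_gt.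
    rewrite big_distrr; over.
  rewrite exchange_big; apply: eq_bigr => i _ /=.
  under eq_bigr do rewrite mulnA.
  rewrite -big_distrl -sum_bin_hockey /=.
  rewrite (big_ord_widen n.+1 (binomial^~ h) (leqW (ltnW (ltn_ord i)))).
  congr (_ * _)%N; rewrite [RHS]big_mkcond; apply: eq_bigr => j _.
  by case: ltnP => _; rewrite ?muln1 ?muln0.
under eq_bigr do rewrite size_up_walksS mulnDr.
rewrite big_split {}sum_tails.
rewrite big_ord_recl size_motzkin_walksS !IHn; congr (_ + _)%N.
(* The split-off term [j = 0] contributes only for height index [0]; for positive index the
   remaining terms combine by Pascal's rule. *)
case: h => [|h].
  by rewrite IH0 mul1n; congr (_ + _)%N; apply: eq_bigr => i _; rewrite !bin0.
rewrite IHn mul0n /= add0n -big_split; apply: eq_bigr => i _ /=.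
by rewrite /bump binS mulnDl addnC.
Qed.

(** * The Motzkin generating function *)

Lemma coef_X_mul (f : fps) n :
  coef (fps_X * f) n = if n is m.+1 then coef f m else 0.
Proof.
rewrite coefM_fps; case: n => [|n]; first by rewrite big_ord1 mul0r.
rewrite !big_ord_recl mul0r add0r mul1r big1 ?addr0 => [|i _].
  by rewrite subSS subn0.
by rewrite mul0r.
Qed.

Lemma coef_expr_motzkin (f : fps) : f = 1 + fps_X * (f + fps_X * f ^+ 2) ->
  forall n h, coef ((fps_X * f) ^+ h * f) n = (size (motzkin_walks n h))%:R.
Proof.
move=> fE.
have step0 : f = 1 + fps_X * (f + fps_X * f * f) by rewrite {1}fE expr2 mulrA.
(* Expanding one factor [f] by its equation splits the walks by their first step: down, flat or
   up. *)
have stepS h : (fps_X * f) ^+ h.+1 * f = fps_X * ((fps_X * f) ^+ h * f +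
    (fps_X * f) ^+ h.+1 * f + (fps_X * f) ^+ h.+2 * f).
  rewrite !exprS; set A := _ ^+ h.
  transitivity (fps_X * A * f * f); first by ring.
  by rewrite {2}fE; ring.
elim=> [|n IHn] [|h].
- by rewrite mul1r fE -[LHS]/(1 + coef (fps_X * _) 0) coef_X_mul addr0.
- by rewrite stepS coef_X_mul.
- rewrite mul1r step0 -[coef _ _]/(0 + coef (fps_X * _) n.+1) add0r coef_X_mul.
  rewrite -[coef _ _]/(coef f n + coef _ n) size_motzkin_walksS add0n natrD.
  by rewrite -!IHn mul1r expr1.
- by rewrite stepS coef_X_mul size_motzkin_walksS !natrD -!IHn.
Qed.

Lemma double_X2_neq0 : 2 * fps_X ^+ 2 != 0.
Proof.
apply/eqP => /(congr1 (fun f => coef f 2)).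
by rewrite (_ : 2 * _ = fps_X * (fps_X * (1 + 1))) ?coef_X_mul //; ring.
Qed.

(** Completing the square: the difference of the two sides, times the square of [2 * fps_X ^+ 2], is
    [fps_X ^+ 2] times the discriminant minus [s ^+ 2]. Cancellation in the domain of series
    replaces division. *)
Lemma motzkin_equation (f s : fps) :
  s ^+ 2 = 1 - 2 * fps_X - 3 * fps_X ^+ 2 ->
  2 * fps_X ^+ 2 * f = 1 - fps_X - s -> f = 1 + fps_X * (f + fps_X * f ^+ 2).
Proof.
move=> s2 fE; have sE : s = 1 - fps_X - 2 * fps_X ^+ 2 * f by rewrite fE; ring.
apply/eqP; rewrite -subr_eq0; apply/eqP.
apply: (mulfI double_X2_neq0); apply: (mulfI double_X2_neq0); rewrite !mulr0.
transitivity (fps_X ^+ 2 * (1 - 2 * fps_X - 3 * fps_X ^+ 2 - s ^+ 2)).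
  by rewrite sE; ring.
by rewrite s2 subrr mulr0.
Qed.

Lemma motzkin_series : exists f : fps,
  2 * fps_X ^+ 2 * f =
    1 - fps_X - fps_sqrt (1 - 2 * fps_X - 3 * fps_X ^+ 2) /\
  f = 1 + fps_X * (f + fps_X * f ^+ 2).
Proof.
set d := 1 - 2 * fps_X - 3 * fps_X ^+ 2.
have [s0 s2] : coef (fps_sqrt d) 0 = 1 /\ fps_sqrt d ^+ 2 = d.
  apply: fps_sqrtP.
  have -> : d = 1 - fps_X * (2 + 3 * fps_X) by rewrite /d; ring.
  by rewrite -[coef _ _]/(1 - coef (fps_X * _) 0) coef_X_mul subr0.
set s := fps_sqrt d in s0 s2 *.
(* Comparing coefficients of degree one in [s ^+ 2 = d] gives twice this value equal to [-2]. *)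
have s1 : coef s 1 = -1.
  have := congr1 (fun g => coef g 1) s2.
  have -> : d = 1 - (fps_X + fps_X + fps_X * (fps_X * 3)) by rewrite /d; ring.
  rewrite -[coef (1 - _) 1]/(0 - (1 + 1 + coef (fps_X * _) 1)) !coef_X_mul.
  by rewrite expr2 coefM_fps !big_ord_recl big_ord0 /= s0; lra.
(* The numerator has no terms of degree [0] or [1], so its quotient by [2 * fps_X ^+ 2] is a shift
   by two and a halving. *)
pose f := Fps (fun n => coef (1 - fps_X - s) n.+2 / 2).
have fE : 2 * fps_X ^+ 2 * f = 1 - fps_X - s.
  have -> : 2 * fps_X ^+ 2 * f = fps_X * (fps_X * (f + f)) by ring.
  apply: fpsP => n; rewrite coef_X_mul; case: n => [|n].
    by rewrite /= s0; lra.
  rewrite coef_X_mul; case: n => [|n]; first by rewrite /= s1; lra.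
  by rewrite -[coef (f + f) n]/(coef f n + coef f n) /=; lra.
by exists f; split=> //; apply: motzkin_equation fE.
Qed.

Theorem theorem6 :
  tofrac (ogf num_U_classes)
    = tofrac (1 - fps_X - fps_sqrt (1 - 2 * fps_X - 3 * fps_X ^+ 2))
      / tofrac (2 * fps_X ^+ 2)
  /\ ogf num_U_classes = ogf motzkin_number.
Proof.
have eq_gf : ogf num_U_classes = ogf motzkin_number.
  apply: fpsP => n /=.
  by rewrite num_U_classesE motzkin_numberE (size_motzkin_walks_up n).1.
split=> //; have [f [fE f_eq]] := motzkin_series.
have -> : ogf num_U_classes = f.
  rewrite eq_gf; apply: fpsP => n /=.
  by rewrite motzkin_numberE -(coef_expr_motzkin f_eq) mul1r.
rewrite -fE rmorphM /= mulrAC mulfV ?mul1r //.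
by rewrite tofrac_eq0 double_X2_neq0.
Qed.
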